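(* Let $P$ be a combinatorial specification all of whose rules are produced by productive strategies. Then $P$ is productive, i.e., the infinite system of equations derived from its counting functions has a unique solution.
   Context: A combinatorial set is a set of objects each with a size in $\mathbb{N}$, finitely many of each size; $\mathcal{A}_n$ denotes its objects of size $n$. An $m$-ary combinatorial strategy $S$ ($m\ge0$) consists of a decomposition function $d_S$ (sending a combinatorial set to an $m$-tuple of combinatorial sets or to DNA), a reliance profile function $r_S:\mathbb{N}\to\mathbb{Z}^m$, and counting functions $c_{S,(n)}$ such that whenever $d_S(\mathcal{A})=(\mathcal{B}^{(1)},\ldots,\mathcal{B}^{(m)})$, $c_{S,(n)}$ applied to the tuples $(|\mathcal{B}^{(i)}_0|,\ldots,|\mathcal{B}^{(i)}_{r^{(i)}_S(n)}|)$ equals $|\mathcal{A}_n|$; this gives the rule $\mathcal{A}\xleftarrow{S}(\mathcal{B}^{(1)},\ldots,\mathcal{B}^{(m)})$, and $\mathcal{A}_N$ relies on $\mathcal{B}^{(i)}_j$ when $0\le j\le r^{(i)}_S(N)$. A combinatorial specification is a set of rules such that every set on a right-hand side is the left-hand side of exactly one rule. If the specification involves the sets $\mathcal{B}^{(1)},\ldots,\mathcal{B}^{(N)}$ with rules $\mathcal{B}^{(j)}\xleftarrow{S_j}(\mathcal{B}^{(i_{j,1})},\ldots,\mathcal{B}^{(i_{j,m_j})})$, its system of equations is, for all $j$ and $n\in\mathbb{N}$, $b^{(j)}_n=c_{S_j,(n)}\big((b^{(i_{j,1})}_0,\ldots,b^{(i_{j,1})}_{r^{(1)}_{S_j}(n)}),\ldots,(b^{(i_{j,m_j})}_0,\ldots,b^{(i_{j,m_j})}_{r^{(m_j)}_{S_j}(n)})\big)$,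 and the specification is productive if this system has a unique solution in $(\mathbb{C}^{\mathbb{N}})^N$. A strategy $S$ is productive if for every $\mathcal{A}$ with $d_S(\mathcal{A})=(\mathcal{B}^{(1)},\ldots,\mathcal{B}^{(m)})$ and every $i$: (1) if $\mathcal{A}_N$ relies on $\mathcal{B}^{(i)}_j$ then $j\le N$; (2) if $\mathcal{A}_N$ relies on $\mathcal{B}^{(i)}_N$ for some $N$, then $|\mathcal{A}_n|\ge|\mathcal{B}^{(i)}_n|$ for all $n$ and $|\mathcal{A}_\ell|>|\mathcal{B}^{(i)}_\ell|$ for some $\ell$. *)

(* Defs.v *)
From HB Require Import structures.
From mathcomp Require Import all_boot all_order all_algebra.
From mathcomp Require Import all_classical all_reals.
From mathcomp Require Import finmap complex.

Set Implicit Arguments.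
Unset Strict Implicit.
Unset Printing Implicit Defensive.

Import Order.TTheory GRing.Theory Num.Theory.

Local Open Scope classical_set_scope.
Local Open Scope ring_scope.

Record combSet := CombSet {
  obj :> Type;
  osize : obj -> nat;
  osize_fin : forall n : nat, finite_set [set x : obj | osize x = n]
}.

(* {classic _} supplies the choiceType structure required by fset_set. *)
Definition osize_count (A : combSet) (n : nat) : nat :=
  #|` fset_set [set x : {classic obj A} | osize x = n] |.

(* The number of indices j with 0 <= j <= z: an entry z of a reliance profile
   calls for the terms b_0, ..., b_z, hence for none when z < 0. *)
Definition nterms (z : int) : nat := if z is Posz k then k.+1 else 0%N.

Definition initseg (T : Type) (z : int) (b : nat -> T) : (nterms z).-tuple T :=
  [tuple b j | j < nterms z].

(* None stands for DNA.  The counting functions are functions of complex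
   arguments because the system of a specification is solved over R[i]. *)
Record strategy (R : realType) (m : nat) := Strategy {
  decomp : combSet -> option ('I_m -> combSet);
  reliance : nat -> 'I_m -> int;
  counting : forall n : nat,
    (forall i : 'I_m, (nterms (reliance n i)).-tuple R[i]) -> R[i];
  countingE : forall (A : combSet) (B : 'I_m -> combSet),
    decomp A = Some B ->
    forall n : nat,
      counting (fun i => initseg (reliance n i) (fun j => (osize_count (B i) j)%:R))
      = (osize_count A n)%:R
}.

Definition relies (R : realType) (m : nat) (S : strategy R m)
  (N : nat) (i : 'I_m) (j : nat) : Prop :=
  0 <= j%:Z <= reliance S N i.

Definition productive_strategy (R : realType) (m : nat) (S : strategy R m) :
    Prop :=
  forall (A : combSet) (B : 'I_m -> combSet), decomp S A = Some B ->
  forall i : 'I_m,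
    (forall N j : nat, relies S N i j -> (j <= N)%N) /\
    ((exists N : nat, relies S N i N) ->
       (forall n : nat, (osize_count (B i) n <= osize_count A n)%N) /\
       (exists l : nat, (osize_count (B i) l < osize_count A l)%N)).

Record rule (R : realType) := Rule {
  arity : nat;
  strat : strategy R arity;
  lhs : combSet;
  rhs : 'I_arity -> combSet;
  ruleP : decomp strat lhs = Some rhs
}.

Definition specification (R : realType) (P : set (rule R)) : Prop :=
  finite_set P /\
  forall p : rule R, P p -> forall i : 'I_(arity p),
    exists! q : rule R, P q /\ lhs q = rhs i.

Definition involved (R : realType) (P : set (rule R)) (A : combSet) : Prop :=
  exists2 p : rule R, P p & lhs p = A \/ exists i : 'I_(arity p), rhs i = A.

Lemma lhs_involved (R : realType) (P : set (rule R)) (p : rule R) :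
  P p -> involved P (lhs p).
Proof. by move=> Pp; exists p => //; left. Qed.

Lemma rhs_involved (R : realType) (P : set (rule R)) (p : rule R)
  (i : 'I_(arity p)) : P p -> involved P (rhs i).
Proof. by move=> Pp; exists p => //; right; exists i. Qed.

(* The unknowns of the system are one sequence for each set involved in P. *)
Definition unknowns (R : realType) (P : set (rule R)) : Type :=
  {A : combSet | involved P A} -> nat -> R[i].

Definition solution (R : realType) (P : set (rule R)) (b : unknowns P) : Prop :=
  forall (p : rule R) (Pp : P p) (n : nat),
    b (exist _ (lhs p) (lhs_involved Pp)) n =
    counting (fun i : 'I_(arity p) =>
      initseg (reliance (strat p) n i)
             (b (exist _ (rhs i) (rhs_involved i Pp)))).

Definition productive_specification (R : realType) (P : set (rule R)) : Prop :=
  exists! b : unknowns P, solution b.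

(* Main.v *)
Require Import Defs.
From HB Require Import structures.
From mathcomp Require Import all_boot all_order all_algebra.
From mathcomp Require Import all_classical all_reals.
From mathcomp Require Import complex.

(** The true counting sequences solve the system.  For uniqueness, compare two
    solutions by strong induction on the size [n].  A term of size [n] relies
    only on terms of size at most [n], and when it relies on a term of size
    [n] of another set, the counts weakly decrease everywhere and strictly
    decrease somewhere.  As there are finitely many rules, one bound [M] makes
    all these strict decreases visible below [M], so the number of objects of
    size less than [M] is a measure for an inner induction at fixed [n]. *)

Set Implicit Arguments.
Unset Strict Implicit.
Unset Printing Implicit Defensive.

Local Open Scope classical_set_scope.

Lemma finite_set_eventually (T : Type) (D : set T) (Q : T -> nat -> Prop) :
  finite_set D ->
  (forall x, D x -> exists M, forall m, M <= m -> Q x m) ->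
  exists M, forall x, D x -> forall m, M <= m -> Q x m.
Proof.
move=> finD evQ.
have /choice[f fP] : forall x, exists M, D x -> forall m, M <= m -> Q x m.
  move=> x; have [/evQ[M QM]|nDx] := pselect (D x); first by exists M.
  by exists 0.
have /finite_seqP[s sE] : finite_set (f @` D) by exact: finite_image.
exists (\max_(k <- s) k) => x Dx m leMm; apply: fP => //.
apply: leq_trans leMm; apply: leq_bigmax_seq => //.
by have : [set` s] (f x) by rewrite -sE; exists x.
Qed.

Lemma initseg_eq (T : Type) (z : int) (b c : nat -> T) :
  (forall j : nat, (0 <= j%:Z <= z)%R -> b j = c j) ->
  initseg z b = initseg z c.
Proof.
move=> bc; apply: eq_from_tnth => j; rewrite !tnth_mktuple; apply: bc.
by case: z j => [k|k] [j /= ltj].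
Qed.

Definition count_below (M : nat) (A : combSet) : nat :=
  \sum_(l < M) osize_count A l.

Lemma ltn_count_below (A B : combSet) (l M : nat) :
  (forall n, osize_count B n <= osize_count A n) ->
  osize_count B l < osize_count A l ->
  l < M -> count_below M B < count_below M A.
Proof.
move=> leBA ltl lM; rewrite /count_below (bigD1 (Ordinal lM)) //=.
rewrite [ltnRHS](bigD1 (Ordinal lM)) //= -addSn leq_add //.
by apply: leq_sum => i _.
Qed.

Section Specification.

Variables (R : realType) (P : set (rule R)).

Definition true_counts : unknowns P :=
  fun A n => ((osize_count (sval A) n)%:R)%R.

Lemma true_counts_solution : solution true_counts.
Proof. by move=> p Pp n; rewrite (countingE (ruleP p)). Qed.

Hypothesis specP : specification P.

Lemma involved_lhs (A : combSet) :
  involved P A -> exists2 p : rule R, P p & lhs p = A.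
Proof.
case=> p Pp [<-|[i <-]]; first by exists p.
by have [q [[Pq qE] _]] := specP.2 _ Pp i; exists q.
Qed.

Hypothesis prodP : forall p : rule R, P p -> productive_strategy (strat p).

Lemma reliance_measure : exists M, forall p : rule R, P p ->
  forall (i : 'I_(arity p)) (N : nat), relies (strat p) N i N ->
  count_below M (rhs i) < count_below M (lhs p).
Proof.
have [M MP] : exists M, forall p, P p -> forall m, M <= m ->
    forall (i : 'I_(arity p)) N, relies (strat p) N i N ->
    count_below m (rhs i) < count_below m (lhs p).
  apply: finite_set_eventually; first exact: specP.1.
  move=> p Pp.
  have [M MP] : exists M, forall i : 'I_(arity p), setT i -> forall m, M <= m ->
      forall N, relies (strat p) N i N ->
      count_below m (rhs i) < count_below m (lhs p).
    apply: finite_set_eventually => // i _.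
    have [_ prod2] := prodP Pp (ruleP p) i.
    have [/prod2[leBA [l ltl]]|nrel] :=
      pselect (exists N, relies (strat p) N i N).
      by exists l.+1 => m lm _ _; exact: ltn_count_below ltl lm.
    by exists 0 => m _ N relN; case: nrel; exists N.
  by exists M => m Mm i N; apply: MP.
by exists M => p Pp i N; apply: MP.
Qed.

Lemma solution_unique (b c : unknowns P) : solution b -> solution c -> b = c.
Proof.
move=> solb solc; have [M MP] := reliance_measure.
suff bc n (A : combSet) (invA : involved P A) :
    b (exist _ A invA) n = c (exist _ A invA) n.
  by apply/funext => -[A invA]; apply/funext => n.
elim/ltn_ind: n A invA => n IHn A.
have [k] := ubnP (count_below M A); elim: k A => // k IHk A ltA invA.
have [p Pp pA] := involved_lhs invA; case: A / pA in ltA invA *.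
rewrite (Prop_irrelevance invA (lhs_involved Pp)) solb solc; congr counting.
apply: functional_extensionality_dep => i; apply: initseg_eq => j relj.
have [prod1 _] := prodP Pp (ruleP p) i.
have := prod1 _ _ relj; rewrite leq_eqVlt => /predU1P[jn|ltjn]; last exact: IHn.
rewrite jn in relj *; apply: IHk.
by apply: leq_trans (MP _ Pp _ _ relj) _; rewrite -ltnS.
Qed.

End Specification.

Theorem theorem4p5 (R : realType) (P : set (rule R)) :
  specification P ->
  (forall p : rule R, P p -> productive_strategy (strat p)) ->
  productive_specification P.
Proof.
move=> specP prodP; exists (@true_counts R P).
split; first exact: true_counts_solution.
by move=> b solb; apply: solution_unique => //; exact: true_counts_solution.
Qed.
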